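(* Let $O\subseteq Q$ be an order ideal of the type $(B_n,n)$ staircase poset $Q$ described in the context. An $\oplus$-diagram $D$ of shape $O$ is a $\Gamma$-diagram if and only if both of the following hold: (1) whenever a box $z$ with $D(z)=0$ lies above (same column, smaller row index) a box containing $+$, every box of $O$ to the left of $z$ (same row) contains $0$; (2) every diagonal box of $O$ containing $0$ has only $0$'s to its left (in its row).
   Context: $W$ is the Weyl group of type $B_n$ ($n\ge 2$) with simple reflections $s_1,\dots,s_n$, where $s_i s_{i+1}$ has order $3$ for $i\le n-2$, $s_{n-1}s_n$ has order $4$, and other pairs commute; Bruhat order $<$. $Q$ is the set of boxes $(r,c)$ with $1\le r\le n$ (rows numbered top to bottom) and $1\le c\le n-r+1$, box $(r,c)$ labeled $s_{(r,c)}=s_{r+c-1}$; the diagonal boxes are those with $c=n-r+1$ (labeled $s_n$). The order on $Q$ is the transitive closure of $(r,c)\lessdot(r,c+1)$ and $(r,c)\lessdot(r-1,c)$; order ideals are down-closed subsets. An $\oplus$-diagram of shape $O$ is a map $D:O\to\{0,+\}$. For a linear extension $b_1,\dots,b_m$ of $O$ set $s_{i_t}:=s_{b_{m+1-t}}$ (so $s_{i_1}\cdots s_{i_m}=s_{b_m}\cdots s_{b_1}$, a reduced word), and let $t_t=s_{i_t}$ if $D(b_{m+1-t})=0$, $t_t=1$ if $D(b_{m+1-t})=+$; $v_{(0)}=1$, $v_{(k)}=t_1\cdots t_k$. $D$ is a $\Gamma$-diagram if $v_{(k-1)}<v_{(k-1)}s_{i_k}$ for all $k=1,\dots,m$ (this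 does not depend on the linear extension). *)

(* Defs.v *)
From mathcomp Require Import all_boot all_fingroup.

Set Implicit Arguments.
Unset Strict Implicit.
Unset Printing Implicit Defensive.

Local Open Scope group_scope.

(* Rows, columns and simple reflections are numbered from 0: the ordinal i
   stands for s_(i+1), and the box (r, c) for (r+1, c+1). *)

Definition coxgroup (gT : finGroupType) (n : nat) (s : 'I_n -> gT)
  : {group gT} := <<[set s i | i : 'I_n]>>%G.

Definition has_word (gT : finGroupType) (n : nat) (s : 'I_n -> gT)
    (w : gT) (k : nat) : bool :=
  [exists e : k.-tuple 'I_n, w == \prod_(i <- e) s i].

Lemma has_word_ex (gT : finGroupType) (n : nat) (s : 'I_n -> gT) (w : gT) :
  exists k, (w \in coxgroup s) ==> has_word s w k.
Proof.
have [/gen_prodgP[k [c cS ->]] | _] := boolP (w \in coxgroup s);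
  last by exists 0.
exists k => /=.
have cE (i : 'I_k) : exists j, c i == s j.
  by have /imsetP[j _ ->] := cS i; exists j.
apply/existsP; exists [tuple xchoose (cE i) | i < k]; apply/eqP.
rewrite big_tuple; apply: eq_bigr => i _.
by rewrite tnth_mktuple; apply/eqP/(xchooseP (cE i)).
Qed.

(* Minimal word length; the value outside the group generated by s (where it
   is 0) is never used. *)
Definition coxlength (gT : finGroupType) (n : nat) (s : 'I_n -> gT) (w : gT)
  : nat := ex_minn (has_word_ex s w).

Definition reflection (gT : finGroupType) (n : nat) (s : 'I_n -> gT)
    (t : gT) : bool :=
  [exists i : 'I_n, exists x in coxgroup s, t == s i ^ x].

Definition bruhat_step (gT : finGroupType) (n : nat) (s : 'I_n -> gT)
  : rel gT :=
  [rel u w | reflection s (u^-1 * w) && (coxlength s u < coxlength s w)].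

Definition bruhat_lt (gT : finGroupType) (n : nat) (s : 'I_n -> gT)
  : rel gT :=
  [rel u w | (u != w) && connect (bruhat_step s) u w].

(* The Weyl group of type B_n is coxgroup (@simpleB n), the group of signed
   permutations: (j, false) and (j, true) stand for the vectors e_j and - e_j,
   and, numbering from 1, s_i is the reflection in the root e_i - e_(i+1) for
   i < n and s_n the reflection in e_n. *)
Definition simpleB (n : nat) (i : 'I_n) : {perm 'I_n * bool} :=
  if insub i.+1 is Some j
  then tperm (i, false) (j, false) * tperm (i, true) (j, true)
  else tperm (i, false) (i, true).

Definition box (n : nat) := {p : 'I_n * 'I_n | p.1 + p.2 < n}.

Definition box_row (n : nat) (z : box n) : nat := (val z).1.
Definition box_col (n : nat) (z : box n) : nat := (val z).2.

Definition label (n : nat) (z : box n) : 'I_n := Ordinal (valP z).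

Definition diagonal (n : nat) (z : box n) : bool :=
  (box_row z + box_col z).+1 == n.

Definition box_cover (n : nat) : rel (box n) :=
  [rel x y | ((box_row y == box_row x) && (box_col y == (box_col x).+1))
          || ((box_row x == (box_row y).+1) && (box_col y == box_col x))].

Definition box_le (n : nat) : rel (box n) := connect (@box_cover n).

Definition order_ideal (n : nat) (O : {set box n}) : Prop :=
  forall x y : box n, box_le x y -> y \in O -> x \in O.

Definition box_in (n : nat) (O : {set box n}) := {z : box n | z \in O}.

Definition linear_extension (n : nat) (O : {set box n}) (m : nat)
    (b : m.-tuple (box_in O)) : Prop :=
  [/\ uniq b,
      forall z : box_in O, z \in b
    & forall i j : 'I_m, box_le (val (tnth b i)) (val (tnth b j)) -> i <= j].

Variant entry := Zero | Plus.

Definition oplus_diagram (n : nat) (O : {set box n}) := box_in O -> entry.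

(* With b numbered from 0, word_box b k is the box b_(m+1-t) for t = k+1. *)
Definition word_box (n : nat) (O : {set box n}) (m : nat)
    (b : m.-tuple (box_in O)) (k : 'I_m) : box_in O := tnth b (rev_ord k).

Definition word_refl (n : nat) (O : {set box n}) (m : nat)
    (b : m.-tuple (box_in O)) (k : 'I_m) : {perm 'I_n * bool} :=
  simpleB (label (val (word_box b k))).

Definition word_factor (n : nat) (O : {set box n}) (m : nat)
    (b : m.-tuple (box_in O)) (D : oplus_diagram O) (k : 'I_m)
  : {perm 'I_n * bool} :=
  if D (word_box b k) is Zero then word_refl b k else 1.

(* v_(k), the product of the first k factors in increasing order. *)
Definition subword_prod (n : nat) (O : {set box n}) (m : nat)
    (b : m.-tuple (box_in O)) (D : oplus_diagram O) (k : nat)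
  : {perm 'I_n * bool} :=
  \prod_(j < m | j < k) word_factor b D j.

Definition gamma_diagram (n : nat) (O : {set box n}) (m : nat)
    (b : m.-tuple (box_in O)) (D : oplus_diagram O) : Prop :=
  forall k : 'I_m,
    bruhat_lt (@simpleB n) (subword_prod b D k)
              (subword_prod b D k * word_refl b k).

Definition left_of (n : nat) (x z : box n) : bool :=
  (box_row x == box_row z) && (box_col x < box_col z).

Definition above (n : nat) (z y : box n) : bool :=
  (box_col z == box_col y) && (box_row z < box_row y).

(* Main.v *)
Require Import Defs.
From mathcomp Require Import all_boot all_fingroup zify.

(** Read a diagram as a network of pipes: two pipes enter each box, from the
    top and from the right, cross at a [0] and bounce off each other at a [+];
    the single pipe reaching a diagonal box from the top turns left, changing
    sign at a [0].  Pipe values are compared in the order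
    e_1, ..., e_n, -e_n, ..., -e_1, and by the exchange condition the diagram
    is a Gamma-diagram iff at every box the top pipe comes before the right
    one (is positive, at a diagonal box).

    If (1) fails, then in a smallest rectangle with a [0] in the upper right
    corner and [+] in the two adjacent corners, the pipes crossing at the [0]
    run straight around the rectangle and meet in the wrong order at the fourth
    corner.  If (2) fails, a negative pipe is sent down into a diagonal box.
    Under (1) and (2), after a crossing one of the two pipes runs straight to
    the border, so the pair never meets again in the wrong order. *)

Set Implicit Arguments.
Unset Strict Implicit.
Unset Printing Implicit Defensive.

(** * Pipe networks *)

Section Pipes.

(* At step [k] the box [(row k, col k)] is read, and [P k i] is the pipe at
   position [i] before that step. *)
Variables (n m : nat) (row col : nat -> nat) (inO plus : nat -> nat -> bool).
Variables (time P : nat -> nat -> nat).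

Hypothesis inO_lt : forall r c, inO r c -> r + c < n.
Hypothesis inO_ideal : forall r c r' c',
  inO r' c' -> r' <= r -> c <= c' -> r + c < n -> inO r c.
Hypothesis time_mono : forall r c r' c',
  inO r c -> inO r' c' -> r' <= r -> c <= c' -> time r' c' <= time r c.
Hypothesis time_lt : forall r c, inO r c -> time r c < m.
Hypothesis row_time : forall r c, inO r c -> row (time r c) = r.
Hypothesis col_time : forall r c, inO r c -> col (time r c) = c.
Hypothesis inO_box : forall k, k < m -> inO (row k) (col k).
Hypothesis time_box : forall k, k < m -> time (row k) (col k) = k.
Hypothesis plus_inO : forall r c, plus r c -> inO r c.
Hypothesis P0 : forall i, i < n -> P 0 i = i.
(** A zero at label [l] swaps the pipes at positions [l] and [l + 1]. On the diagonal it sends the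
    value at [l] to [2n - 1] minus that value, the code of the opposite vector. *)
Hypothesis PS : forall k i, k < m -> i < n ->
  P k.+1 i =
    let l := row k + col k in
    if plus (row k) (col k) then P k i
    else if i == l then if l.+1 < n then P k l.+1 else (n + n).-1 - P k l
    else if i == l.+1 then P k l else P k i.

(** The values below [n] encode [e_1, ..., e_n], so the bound [n] on the diagonal says that the pipe
    is positive. *)
Definition increasing_steps := forall k, k < m ->
  let l := row k + col k in P k l < (if l.+1 < n then P k l.+1 else n).

Definition no_bad_hook := forall r r' c c',
  inO r c -> ~~ plus r c -> plus r' c -> r < r' -> c' < c -> ~~ plus r c'.

Definition zero_left_of_diagonal := forall r c c',
  inO r c -> (r + c).+1 = n -> ~~ plus r c -> c' < c -> ~~ plus r c'.

(** * Following a pipe from box to box *)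

Lemma time_inj r c r' c' :
  inO r c -> inO r' c' -> time r c = time r' c' -> r = r' /\ c = c'.
Proof.
move=> h h' e; split.
  by rewrite -(row_time h) e row_time.
by rewrite -(col_time h) e col_time.
Qed.

Lemma time_ltn r c r' c' : inO r c -> inO r' c' -> r' <= r -> c <= c' ->
  (r' != r) || (c' != c) -> time r' c' < time r c.
Proof.
move=> h h' hr hc hne; rewrite ltn_neqAle time_mono // andbT.
by apply/eqP => /(time_inj h' h) [e1 e2]; move: hne; rewrite e1 e2 !eqxx.
Qed.

(* The pipes entering box (r, c). *)
Definition top r c := P (time r c) (r + c).
Definition right r c := P (time r c) (r + c).+1.

Lemma P_untouched i k1 k2 : i < n -> k1 <= k2 -> k2 <= m ->
  (forall k, k1 <= k < k2 ->
     (row k + col k != i) && ((row k + col k).+1 != i)) ->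
  P k2 i = P k1 i.
Proof.
move=> hi; elim: k2 => [|k2 IH] hk hm hun; first by move: hk; case: k1 hun.
have [e|hlt] := eqVneq k1 k2.+1; first by rewrite e.
have {}hk : k1 <= k2 by lia.
have {}IH := IH hk (ltnW hm) (fun k h => hun k ltac:(lia)).
have /andP [h1 h2] := hun k2 ltac:(lia).
rewrite PS //= eq_sym (negbTE h1) eq_sym (negbTE h2) IH.
by case: (plus _ _).
Qed.

(** The boxes with labels [r + c] and [r + c + 1], the only ones touching position [r + c + 1], form
    a chain in the order. Since [(r, c + 1)] and [(r, c)] are neighbours in it, the position is not
    touched between their reading times. The same chain gives [top_next]. *)
Lemma right_next r c : inO r c.+1 ->
  right r c = if plus r c.+1 then top r c.+1
              else if (r + c.+1).+1 < n then right r c.+1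
              else (n + n).-1 - top r c.+1.
Proof.
move=> h; have hl := inO_lt h.
have h' : inO r c by apply: inO_ideal h _ _ _; lia.
have lt : time r c.+1 < time r c by apply: time_ltn => //; lia.
rewrite /right (P_untouched (k1 := (time r c.+1).+1)) //.
- rewrite PS //; [|exact: time_lt | by lia].
  rewrite row_time // col_time //= /top -addnS eqxx.
  by case: (plus _ _).
- by lia.
- exact/ltnW/time_lt.
move=> k /andP [h1 h2].
have km : k < m by have := time_lt h'; lia.
have hk := inO_box km; have tk := time_box km.
have [hr|hr|hr] := ltngtP (row k) r.
- case: (leqP (r + c) (row k + col k)) => hs; last by lia.
  by have := time_mono h hk (ltnW hr) ltac:(lia); lia.
- case: (leqP (row k + col k) (r + c).+1) => hs; last by lia.
  by have := time_mono hk h' (ltnW hr) ltac:(lia); lia.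
apply/andP; split; apply/eqP => hs.
  have hc : col k = c.+1 by lia.
  by move: tk; rewrite hr hc; lia.
have hc : col k = c by lia.
by move: tk; rewrite hr hc; lia.
Qed.

Lemma top_next r c : inO r c -> (r + c).+1 < n ->
  top r.+1 c = if plus r c then right r c else top r c.
Proof.
move=> h hl.
have h' : inO r.+1 c by apply: inO_ideal h _ _ _; lia.
have lt : time r c < time r.+1 c by apply: time_ltn => //; lia.
rewrite /top (P_untouched (k1 := (time r c).+1)) //.
- rewrite PS //; [|exact: time_lt].
  rewrite row_time // col_time //= /right addSn eqxx.
  by case: (plus _ _) => //; case: eqP => // ?; lia.
- exact/ltnW/time_lt.
move=> k /andP [h1 h2].
have km : k < m by have := time_lt h'; lia.
have hk := inO_box km; have tk := time_box km.
have [hr|hr] := leqP (row k) r; last first.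
  have [hr'|hr'] := eqVneq (row k) r.+1.
    apply/andP; split; apply/eqP => hs.
      have hc : col k = c by lia.
      by move: tk; rewrite hr' hc; lia.
    by have := time_mono hk h' ltac:(lia) ltac:(lia); lia.
  case: (leqP (row k + col k) (r + c).+1) => hs; last by lia.
  by have := time_mono hk h' ltac:(lia) ltac:(lia); lia.
case: (leqP (r + c) (row k + col k)) => hs; last by lia.
by have := time_mono h hk ltac:(lia) ltac:(lia); lia.
Qed.

Lemma right_straight r c c' : inO r c -> c' <= c ->
  (r + c).+1 < n -> (forall j, c' < j <= c -> ~~ plus r j) ->
  right r c' = right r c.
Proof.
elim: c => [|c IH] h hc hl hz; first by have -> : c' = 0 by lia.
have [e|hne] := eqVneq c' c.+1; first by rewrite e.
rewrite IH; [|by apply: inO_ideal h _ _ _; lia|lia|lia|]; last first.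
  by move=> j hj; apply: hz; lia.
by rewrite right_next // (negbTE (hz _ _)) ?hl //; lia.
Qed.

Lemma top_straight r r' c : inO r c -> r <= r' -> r' + c < n ->
  (forall j, r <= j < r' -> ~~ plus j c) -> top r' c = top r c.
Proof.
move=> h; elim: r' => [|r' IH] hr hl hz; first by have -> : r = 0 by lia.
have [e|hne] := eqVneq r r'.+1; first by rewrite e.
have h' : inO r' c by apply: inO_ideal h _ _ _; lia.
rewrite top_next // (negbTE (hz _ _)) ?IH //; try lia.
by move=> j hj; apply: hz; lia.
Qed.

(** * Necessity of the two conditions *)

Lemma increasing_box : increasing_steps -> forall r c, inO r c ->
  top r c < (if (r + c).+1 < n then right r c else n).
Proof.
move=> inc r c h; have := inc _ (time_lt h).
by rewrite /= row_time // col_time.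
Qed.

(** Induction on the half-perimeter of the rectangle: a further plus inside any of its four sides
    gives a smaller bad hook, so the sides contain only zeros between the corners. *)
Lemma increasing_no_bad_hook : increasing_steps -> no_bad_hook.
Proof.
move=> /increasing_box inc r r' c c'.
have [s] := ubnP ((r' - r) + (c - c')).
elim: s => // s IH in r r' c c' *; move=> hs h hz hy hr hc.
apply/negP => hx.
have hy' := inO_lt (plus_inO hy).
have inb i j : r <= i -> i <= r' -> j <= c -> inO i j.
  by move=> *; apply: inO_ideal h _ _ _; lia.
have row0 j : c' < j < c -> ~~ plus r j.
  move=> hj; apply/negP => hp.
  by have := IH r r' c j ltac:(lia) h hz hy hr ltac:(lia); rewrite hp.
have col0 i : r < i < r' -> ~~ plus i c.
  move=> hi; apply/negP => hp.
  by have := IH r i c c' ltac:(lia) h hz hp ltac:(lia) hc; rewrite hx.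
have col1 i : r < i < r' -> ~~ plus i c'.
  move=> hi; apply/negP => hp.
  have := IH i r' c c' ltac:(lia) (inb i c ltac:(lia) ltac:(lia) ltac:(lia))
    (col0 i hi) hy ltac:(lia) hc.
  by rewrite hp.
have row1 j : c' < j < c -> ~~ plus r' j.
  move=> hj; apply/negP => hp.
  have := IH r r' j c' ltac:(lia) (inb r j ltac:(lia) ltac:(lia) ltac:(lia))
    (row0 j hj) hp hr ltac:(lia).
  by rewrite hx.
(* [e1] and [e2] follow one pipe left from [(r, c)], then down from the plus at [(r, c')]. [e3] and
   [e4] follow the other down, then left from the plus at [(r', c)]. At [(r', c')] they have
   exchanged the roles of top and right. *)
have e1 : right r c' = right r c.
  apply: right_straight => //; try lia.
  move=> j hj; have [->//|?] := eqVneq j c; apply: row0; lia.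
have e2 : top r' c' = right r c'.
  have := top_next (inb r c' ltac:(lia) ltac:(lia) ltac:(lia)) ltac:(lia).
  rewrite hx => <-; apply: top_straight; try lia.
    by apply: inb; lia.
  by move=> j hj; apply: col1; lia.
have e3 : top r' c = top r c.
  apply: top_straight => //; try lia.
  move=> j hj; have [->//|?] := eqVneq j r; apply: col0; lia.
have e4 : right r' c' = top r' c.
  case: c {hz hs col0 e1 e3} h hy hc hy' inb row0 row1 => // c.
  move=> h hy hc hy' inb _ row1.
  rewrite (right_straight (c := c)); [|by apply: inb; lia|lia|lia|].
    by rewrite right_next ?hy //; apply: plus_inO.
  by move=> j hj; apply: row1; lia.
have hxy : inO r' c' by apply: inb; lia.
have := inc r c h; have := inc r' c' hxy.
by rewrite !ifT; lia.
Qed.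

(* The reflected pipe is sent down by the nearest plus; another plus below it
   would give a bad hook or a lower violation, so the pipe reaches a diagonal
   box from above while negative. *)
Lemma increasing_zero_left_of_diagonal :
  increasing_steps -> zero_left_of_diagonal.
Proof.
move=> incs; have hook := increasing_no_bad_hook incs.
have inc := increasing_box incs.
move=> r c c'; have [s] := ubnP ((n - r) + (c - c')).
elim: s => // s IH in r c c' *; move=> hs h hd hz hc; apply/negP => hx.
have row0 j : c' < j < c -> ~~ plus r j.
  move=> hj; apply/negP => hp.
  by have := IH r c j ltac:(lia) h hd hz ltac:(lia); rewrite hp.
have inb i j : r <= i -> j <= c -> i + j < n -> inO i j.
  by move=> *; apply: inO_ideal h _ _ _; lia.
(* The diagonal box of row [i] decides: a plus there lies below a zero of row [r] and gives a bad
   hook with the plus at [(r, c')]; a zero there contradicts the induction hypothesis in row [i]. *)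
have col0 i : r < i -> (i + c').+1 < n -> ~~ plus i c'.
  move=> hi hic; apply/negP => hp.
  have [hq|hq] := boolP (plus i (n - i).-1).
    have hin : inO r (n - i).-1 by apply: inb; lia.
    have := hook r i (n - i).-1 c' hin (row0 (n - i).-1 ltac:(lia)) hq hi
      ltac:(lia).
    by rewrite hx.
  have hin : inO i (n - i).-1 by apply: inb; lia.
  have := IH i (n - i).-1 c' ltac:(lia) hin ltac:(lia) hq ltac:(lia).
  by rewrite hp.
have e1 : right r c' = (n + n).-1 - top r c.
  case: c h hz hd hc hs inb row0 => // c h hz hd hc hs inb row0.
  rewrite (right_straight (c := c)); try lia.
  - by rewrite right_next // (negbTE hz) ifN //; lia.
  - by apply: inb; lia.
  - by move=> j hj; apply: row0.
have e2 : top (n - c').-1 c' = right r c'.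
  have := top_next (inb r c' ltac:(lia) ltac:(lia) ltac:(lia)) ltac:(lia).
  rewrite hx => <-; apply: top_straight; try lia.
    by apply: inb; lia.
  by move=> j hj; apply: col0; lia.
(* The top pipes of the two diagonal boxes have values adding up to [2n - 1], so they cannot both be
   below [n]. *)
have hin : inO (n - c').-1 c' by apply: inb; lia.
have := inc (n - c').-1 c' hin.
have := inc r c h.
by rewrite !ifN; lia.
Qed.

(** * Sufficiency: an invariant of the reading *)

Definition unread k r c := inO r c && (k <= time r c).

(* Vertex [j] of the lattice path bounding the unread boxes is
   [(cut k j, j - cut k j)], and pipe position [i] crosses the path between
   vertices [i] and [i + 1]. *)
Fixpoint cut k j := if j is i.+1 then
  cut k i + ~~ unread k (cut k i) (i - cut k i) else 0.

Lemma cut_le k j : cut k j <= j.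
Proof. by elim: j => //= j IH; case: (~~ _); lia. Qed.

Lemma cut_step k j : cut k j <= cut k j.+1 <= (cut k j).+1.
Proof. by rewrite /=; case: (~~ _); lia. Qed.

Lemma unread_ideal k r c r' c' :
  unread k r' c' -> r' <= r -> c <= c' -> r + c < n -> unread k r c.
Proof.
move=> /andP [h1 h2] hr hc hl.
have h := inO_ideal h1 hr hc hl; rewrite /unread h.
exact: leq_trans h2 (time_mono h h1 hr hc).
Qed.

(** The unread boxes form an order ideal, so on each antidiagonal they are exactly the boxes from
    some row downwards, and [cut] finds that row. *)
Lemma unread_cut k j r : j <= n -> r < j ->
  unread k r (j.-1 - r) = (cut k j <= r).
Proof.
elim: j r => // j IH r hj hr.
have hcut := cut_le k j; rewrite [j.+1.-1]/=.
have [hlt|hgt|e] := ltngtP r (cut k j).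
- rewrite [cut k j.+1]/= [RHS]leqNgt ltn_addr //=; apply/negbTE/negP => hu.
  suff : unread k r (j.-1 - r) by rewrite IH; lia.
  by apply: unread_ideal hu _ _ _; lia.
- have -> : cut k j.+1 <= r by have := cut_step k j; lia.
  have : unread k r.-1 (j.-1 - r.-1) by rewrite IH; lia.
  by move=> hu; apply: unread_ideal hu _ _ _; lia.
rewrite [cut k j.+1]/= -e; case: (unread _ _ _) => /=; lia.
Qed.

Lemma unread_cutE k r c : r + c < n -> unread k r c = (cut k (r + c).+1 <= r).
Proof.
by move=> h; rewrite -unread_cut //; [congr unread|]; lia.
Qed.

(** The box about to be read is maximal among the unread ones, so the path follows its top edge and
    then, off the diagonal, its right edge. *)
Lemma cut_before k : k < m -> let l := row k + col k in
  [/\ cut k l = row k, cut k l.+1 = row k &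
      l.+1 < n -> cut k l.+2 = (row k).+1].
Proof.
move=> km l; have h := inO_box km; have tk := time_box km.
have hl : l < n := inO_lt h.
have hu : cut k l.+1 <= row k by rewrite -unread_cutE // /unread h tk /=.
have hst := cut_step k l.
have e : cut k l = row k.
  case: (ltnP (cut k l) (row k)) => [hlt|]; last by lia.
  have : unread k (row k).-1 (col k).
    by rewrite unread_cutE; last lia; rewrite (_ : _.+1 = l); lia.
  move=> /andP [h1 h2].
  by have := time_ltn h h1 ltac:(lia) ltac:(lia) ltac:(lia); lia.
split=> // [|hl']; first by lia.
have hst' := cut_step k l.+1.
suff : row k < cut k l.+2 by lia.
rewrite ltnNge; have := @unread_cutE k (row k) (col k).+1 ltac:(lia).
rewrite addnS -/l => <-; apply/negP => /andP [h1 h2].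
by have := time_ltn h h1 ltac:(lia) ltac:(lia) ltac:(lia); lia.
Qed.

(** Vertex [j] depends only on the unread boxes with label [j - 1]. *)
Lemma cut_other k j : k < m -> j <= n -> j != (row k + col k).+1 ->
  cut k.+1 j = cut k j.
Proof.
move=> km hj hne.
have same r : r < j -> (cut k.+1 j <= r) = (cut k j <= r).
  move=> hr; rewrite -!unread_cut // /unread; case: (boolP (inO _ _)) => //= h.
  rewrite [RHS]leq_eqVlt; case: eqP => //= e.
  by have := row_time h; have := col_time h; rewrite -e; lia.
have h1 := cut_le k j; have h2 := cut_le k.+1 j.
apply/eqP; rewrite eqn_leq; apply/andP; split.
  have [->//|hlt] := eqVneq (cut k j) j.
  by rewrite same; lia.
have [->//|hlt] := eqVneq (cut k.+1 j) j.
by rewrite -same; lia.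
Qed.

(** Reading the box moves this vertex of the path from its upper right to its lower left corner. *)
Lemma cut_after k : k < m -> cut k.+1 (row k + col k).+1 = (row k).+1.
Proof.
move=> km; set l := row k + col k.
have hl : l < n := inO_lt (inO_box km).
have [e _ _] := cut_before km.
have e' : cut k.+1 l = row k by rewrite cut_other //; lia.
have hst := cut_step k.+1 l.
suff : row k < cut k.+1 l.+1 by lia.
rewrite ltnNge -unread_cutE // /unread time_box // ltnn andbF //.
Qed.

(* [hstraight]: position [i] is a pipe running straight left to the border;
   [vstraight]: it runs straight down to the diagonal. *)
Definition hstraight k i :=
  cut k i.+1 = (cut k i).+1 /\ forall c, c < i - cut k i -> ~~ plus (cut k i) c.

Definition vstraight k i :=
  cut k i.+1 = cut k i /\ forall r, cut k i <= r -> ~~ plus r (i - cut k i).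

(** A negative pipe may exist only if it never enters a box from the top again. An inverted pair is
    harmless if it cannot meet again: to meet, the pipe at the smaller position must enter from the
    top and the other from the right. *)
Definition pipes_ok k :=
  (forall i, i < n -> n <= P k i -> hstraight k i) /\
  (forall i j, i < j -> j < n ->
     [\/ P k i < P k j, hstraight k i | vstraight k j]).

Lemma pipes_ok0 : pipes_ok 0.
Proof.
split=> [i hi|i j hi hj]; first by rewrite P0 //; lia.
by apply: Or31; rewrite !P0 //; lia.
Qed.

(** The top pipe crosses a horizontal edge of the path, hence is not [hstraight]; the right pipe
    crosses a vertical edge, hence is not [vstraight]. Only the desired alternative of the invariant
    remains. *)
Lemma pipes_ok_increasing k : k < m -> pipes_ok k ->
  let l := row k + col k in P k l < (if l.+1 < n then P k l.+1 else n).
Proof.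
move=> km [neg inv] /=; set l := row k + col k.
have hl : l < n := inO_lt (inO_box km).
have [e1 e2 e3] := cut_before km.
case: ifP => hl'.
  have [//|[]|[]] := inv l l.+1 (ltnSn l) hl'.
    by rewrite -/l in e1 e2 *; lia.
  by have := e3 hl'; rewrite -/l in e1 e2 *; lia.
rewrite ltnNge; apply/negP => /(neg _ hl) [].
by rewrite -/l in e1 e2 *; lia.
Qed.

(** At a plus no straight pipe is involved, and nothing changes. At a zero straight pipes pass
    through and stay straight, so only the pair just crossed and a pipe just negated need the two
    conditions. *)
Lemma pipes_okS k : no_bad_hook -> zero_left_of_diagonal -> k < m ->
  pipes_ok k -> pipes_ok k.+1.
Proof.
move=> hook diag km ok; move: (pipes_ok_increasing km ok) => /= lt.
case: ok => neg inv.
set l := row k + col k in lt *.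
have h := inO_box km.
have hl : l < n := inO_lt h.
have [e1 e2 e3] := cut_before km; rewrite -/l in e1 e2 e3.
have a2 := cut_after km; rewrite -/l in a2.
have a1 : cut k.+1 l = row k by rewrite cut_other //; lia.
have lr : l - row k = col k by lia.
have hsame i : i < n -> i != l -> i != l.+1 ->
    hstraight k i -> hstraight k.+1 i.
  by move=> hi n1 n2; rewrite /hstraight !cut_other //; lia.
have vsame i : i < n -> i != l -> i != l.+1 ->
    vstraight k i -> vstraight k.+1 i.
  by move=> hi n1 n2; rewrite /vstraight !cut_other //; lia.
have nh : ~ hstraight k l by case; lia.
have nv : l.+1 < n -> ~ vstraight k l.+1 by move=> hl' [] ; have := e3 hl'; lia.
have hdown : l.+1 < n -> hstraight k l.+1 ->
    ~~ plus (row k) (col k) /\ hstraight k.+1 l.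
  move=> hl' [_]; rewrite e2 => hz; split; first by apply: hz; lia.
  split; first by rewrite a1 a2.
  by rewrite a1 => c hc; apply: hz; lia.
have vdown : l.+1 < n -> vstraight k l ->
    ~~ plus (row k) (col k) /\ vstraight k.+1 l.+1.
  move=> hl' [_]; rewrite e1 lr => hz; split; first exact: hz.
  split; first by rewrite a2 cut_other ?e3 //; lia.
  rewrite a2 (_ : l.+1 - (row k).+1 = col k); last by lia.
  by move=> r hr; apply: hz; lia.
(* If a plus lies below in the column, [hook] clears the row to the left and the pipe going left is
   straight; otherwise the pipe going down is. *)
have cross : ~~ plus (row k) (col k) -> l.+1 < n ->
    hstraight k.+1 l \/ vstraight k.+1 l.+1.
  move=> hz hl'.
  have [/hasP [r]|hno] :=
    boolP (has (fun r => plus r (col k)) (index_iota (row k).+1 n)).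
    rewrite mem_index_iota => hr hp; left; split; first by rewrite a1 a2.
    rewrite a1 lr => c hc; apply: hook h hz hp _ hc; lia.
  right; split; first by rewrite a2 cut_other ?e3 //; lia.
  rewrite a2 (_ : l.+1 - (row k).+1 = col k); last by lia.
  move=> r hr; apply/negP => hp; move/negP: hno; apply.
  apply/hasP; exists r => //; rewrite mem_index_iota.
  by have := inO_lt (plus_inO hp); lia.
have vplus : vstraight k l -> ~~ plus (row k) (col k).
  by move=> [_]; rewrite e1 lr; apply.
have PE i : i < n -> _ := fun hi => PS km hi.
rewrite /= -/l in PE.
split=> [i hi|i j hij hj].
  rewrite PE //; case: ifP => [hp|/negbT hz].
    move=> /(neg _ hi) hs.
    have [e|n1] := eqVneq i l; first by rewrite e in hs.
    have [e|n2] := eqVneq i l.+1; last exact: hsame.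
    by rewrite e in hi hs; have [] := hdown hi hs; rewrite hp.
  case: eqP => [->|/eqP n1].
    case: ifP => hl'; first by move=> /(neg _ hl') /(hdown hl') [].
    move=> _; split; first by rewrite a1 a2.
    by rewrite a1 lr => c; apply: diag h _ hz; lia.
  case: eqP => [_ /(neg _ hl) //|/eqP n2 /(neg _ hi)]; exact: hsame.
have hi : i < n by lia.
rewrite !PE //; case: ifP => [hp|/negbT hz].
  have nhS : l.+1 < n -> ~ hstraight k l.+1 by move=> hl' /(hdown hl') [] /negP.
  have nvl : ~ vstraight k l by move=> /vplus /negP.
  have keeph : hstraight k i -> hstraight k.+1 i.
    have [->//|n1] := eqVneq i l.
    have [e|n2] := eqVneq i l.+1; last exact: hsame.
    by rewrite e; move=> /(nhS ltac:(lia)).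
  have keepv : vstraight k j -> vstraight k.+1 j.
    have [->//|n1] := eqVneq j l.
    have [e|n2] := eqVneq j l.+1; last exact: vsame.
    by rewrite e; move=> /(nv ltac:(lia)).
  by case: (inv i j hij hj) => hc;
    [apply: Or31 | apply: Or32; auto | apply: Or33; auto].
have [ei|n1] := eqVneq i l.
  have hl' : l.+1 < n by lia.
  rewrite hl'; have [ej|n2] := eqVneq j l; first by lia.
  have [ej'|n3] := eqVneq j l.+1.
    by rewrite ei ej'; case: (cross hz hl') => ?; [apply: Or32|apply: Or33].
  case: (inv l.+1 j ltac:(lia) hj) => hc; first exact: Or31.
    by rewrite ei; apply: Or32; have [] := hdown hl' hc.
  by apply: Or33; apply: vsame.
have [ei|n2] := eqVneq i l.+1.
  rewrite !ifN; [|lia|lia].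
  case: (inv l j ltac:(lia) hj) => hc; [exact: Or31|by []|].
  by apply: Or33; apply: vsame => //; lia.
have [ej|n3] := eqVneq j l.
  case: ifP => hl'.
    case: (inv i l.+1 ltac:(lia) hl') => hc; [exact: Or31| |by case: (nv hl')].
    by apply: Or32; apply: hsame.
  (* The negated pipe has a value of at least [n], so it can only precede a pipe that was already
     negative, and such a pipe is straight. *)
  rewrite hl' in lt; have [hge|hlt] := leqP n (P k i).
    by apply: Or32; apply: hsame => //; apply: neg.
  by apply: Or31; lia.
have [ej|n4] := eqVneq j l.+1.
  case: (inv i l ltac:(lia) hl) => hc; [exact: Or31| |].
    by apply: Or32; apply: hsame.
  by apply: Or33; rewrite ej in hj *; have [] := vdown hj hc.
by case: (inv i j hij hj) => hc;
  [apply: Or31 | apply: Or32; auto | apply: Or33; auto].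
Qed.

Lemma increasing_stepsP :
  increasing_steps <-> no_bad_hook /\ zero_left_of_diagonal.
Proof.
split=> [inc|[hook diag] k km].
  split; first exact: increasing_no_bad_hook.
  exact: increasing_zero_left_of_diagonal.
apply: pipes_ok_increasing => //.
elim: k km => [|k IH] km; first exact: pipes_ok0.
by apply: pipes_okS => //; [lia | apply: IH; lia].
Qed.

End Pipes.

(** * Length in the signed permutation group *)

Local Open Scope group_scope.

Definition bar (n : nat) (x : 'I_n * bool) := (x.1, ~~ x.2).

(* Position of a signed vector in e_1, ..., e_n, -e_n, ..., -e_1: a root
   e_x - e_y is positive iff [rank x < rank y]. *)
Definition rank (n : nat) (x : 'I_n * bool) : nat :=
  if x.2 then (n + n).-1 - x.1 else x.1.

Lemma rank_lt n (x : 'I_n * bool) : rank x < n + n.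
Proof. by case: x => [[i hi] []] /=; rewrite /rank /=; lia. Qed.

Lemma rank_inj n : injective (@rank n).
Proof.
move=> [[i hi] bi] [[j hj] bj]; rewrite /rank /= => e.
have [ei eb] : i = j /\ bi = bj by case: bi bj e => [] [] /=; lia.
by rewrite eb; congr pair; apply: val_inj.
Qed.

Lemma rank_bar n (x : 'I_n * bool) : (rank (bar x) + rank x).+1 = n + n.
Proof. by case: x => [[i hi] []]; rewrite /rank /=; lia. Qed.

(** Both kinds of simple reflection exchange the ranks [i] and [i + 1] and, symmetrically,
    [2n - 1 - i] and [2n - 2 - i]; for [i = n - 1] these are the same pair. The arithmetic form lets
    later facts be settled by cases. *)
Lemma rank_simpleB n (i : 'I_n) x :
  let r := rank x in let s := rank (simpleB i x) in
  r = i /\ s = i.+1 \/ r = i.+1 /\ s = i \/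
  (r + i).+1 = n + n /\ (s + i).+2 = n + n \/
  (r + i).+2 = n + n /\ (s + i).+1 = n + n \/
  s = r /\ r <> i /\ r <> i.+1 /\ (r + i).+1 <> n + n /\ (r + i).+2 <> n + n.
Proof.
have rankF (a : 'I_n) : rank (a, false) = a by [].
have rankT (a : 'I_n) : (rank (a, true) + a).+1 = n + n.
  by have := ltn_ord a; rewrite /rank /=; lia.
rewrite /= /simpleB; case: insubP => [j _ /= hj|hi].
  have hij : i != j by apply/eqP => e; move: hj; rewrite -e /=; lia.
  have hi := ltn_ord i; have hjn := ltn_ord j.
  rewrite permM; case: x => a []; have ha := ltn_ord a.
    rewrite [tperm (i, false) _ _]tpermD ?xpair_eqE ?andbF //.
    have hT := rankT a; have hTi := rankT i; have hTj := rankT j.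
    case: tpermP => [[->]|[->]|/eqP h1 /eqP h2].
    - by right; right; left; lia.
    - by right; right; right; left; lia.
    move: h1 h2; rewrite !xpair_eqE !andbT -!val_eqE /= => h1 h2.
    by do 4!right; lia.
  case: (tpermP (i, false)) => [[->]|[->]|/eqP h1 /eqP h2];
    rewrite tpermD ?xpair_eqE ?andbF // !rankF.
  - by left; lia.
  - by right; left; lia.
  move: h1 h2; rewrite !xpair_eqE !andbT -!val_eqE /= => h1 h2.
  by do 4!right; lia.
have hi' := ltn_ord i; case: x => a c; have ha := ltn_ord a.
case: (tpermP (i, false)) => [[-> ->]|[-> ->]|/eqP h1 /eqP h2].
- by left; have := rankT i; rewrite rankF; lia.
- by right; left; have := rankT i; rewrite rankF; lia.
move: h1 h2; rewrite !xpair_eqE -!val_eqE /=.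
case: c => /=; rewrite ?andbT ?andbF => h1 h2; do 4!right.
  by have := rankT a; lia.
by rewrite rankF; lia.
Qed.

Lemma rank_simpleB_lt n (i : 'I_n) :
  rank (i, false) < rank (simpleB i (i, false)).
Proof.
have := ltn_ord i; have e : rank (i, false) = i by [].
by have := rank_simpleB i (i, false); lia.
Qed.

(** Properties of reflections sufficient for the exchange argument: they survive conjugation by
    simple reflections, and one moved vector and its image determine [g]. *)
Record reflection_like n (g : {perm 'I_n * bool}) : Prop := ReflectionLike {
  refl_bar : forall x, g (bar x) = bar (g x);
  refl_invol : forall x, g (g x) = x;
  refl_support : forall x y, g x != x -> g y != y ->
    [|| y == x, y == g x, y == bar x | y == bar (g x)] }.

Lemma simpleB_reflection n (i : 'I_n) : reflection_like (simpleB i).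
Proof.
split=> [x|x|x y].
- apply: rank_inj; have h1 := rank_bar x; have h2 := rank_bar (simpleB i x).
  have := rank_simpleB i x; have := rank_simpleB i (bar x).
  by move=> /= [[? ?]|[[? ?]|[[? ?]|[[? ?]|[? [? [? [? ?]]]]]]]]
    [[? ?]|[[? ?]|[[? ?]|[[? ?]|[? [? [? [? ?]]]]]]]]; lia.
- apply: rank_inj.
  have := rank_simpleB i x; have := rank_simpleB i (simpleB i x).
  by move=> /= [[? ?]|[[? ?]|[[? ?]|[[? ?]|[? [? [? [? ?]]]]]]]]
    [[? ?]|[[? ?]|[[? ?]|[[? ?]|[? [? [? [? ?]]]]]]]]; lia.
rewrite -!(inj_eq (@rank_inj n)).
have h1 := rank_bar x; have h2 := rank_bar (simpleB i x).
have := rank_simpleB i x; have := rank_simpleB i y.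
by move=> /= [[? ?]|[[? ?]|[[? ?]|[[? ?]|[? _]]]]]
  [[? ?]|[[? ?]|[[? ?]|[[? ?]|[? _]]]]]; lia.
Qed.

Lemma simpleBK n (i : 'I_n) : simpleB i * simpleB i = 1.
Proof.
by apply/permP => x; rewrite permM (refl_invol (simpleB_reflection i)) perm1.
Qed.

Lemma simpleBV n (i : 'I_n) : (simpleB i)^-1 = simpleB i.
Proof. by apply/eqP; rewrite eq_invg_mul simpleBK. Qed.

Lemma reflection_like_conj n (i : 'I_n) (g : {perm 'I_n * bool}) :
  reflection_like g -> reflection_like (simpleB i * g * simpleB i).
Proof.
have [sb sK _] := simpleB_reflection i; move=> [gb gK gs].
have s_inj := can_inj sK.
split=> [x|x|x y]; rewrite !permM ?sb ?gb ?sK ?gK //.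
have sE a c : (simpleB i a == c) = (a == simpleB i c).
  by rewrite -(inj_eq s_inj) sK.
by rewrite !sE => /gs hx /hx; rewrite !sE !sb !sK.
Qed.

Lemma reflection_like_eq n (g h : {perm 'I_n * bool}) x :
  reflection_like g -> reflection_like h -> g x = h x -> g x != x -> g = h.
Proof.
move=> [gb gK gs] [hb hK hs] e hx; apply/permP => z.
have hx' : h x != x by rewrite -e.
have [hin|hout] := boolP [|| z == x, z == g x, z == bar x | z == bar (g x)].
  case/or4P: hin => /eqP ->.
  - exact: e.
  - by rewrite gK e hK.
  - by rewrite gb hb e.
  - by rewrite gb gK hb e hK.
have -> : g z = z by apply/eqP; apply: contraNT hout => /(gs _ _ hx).
by apply/esym/eqP; apply: contraNT hout => /(hs _ _ hx'); rewrite e.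
Qed.

(** A simple reflection exchanges only neighbouring ranks. In terms of roots, it makes no positive
    root negative except its own. *)
Lemma simpleB_inversion n (i : 'I_n) x y : rank x < rank y ->
  rank (simpleB i y) < rank (simpleB i x) -> simpleB i x = y.
Proof.
move=> hxy hyx; apply: rank_inj.
have hx := rank_lt x; have hy := rank_lt y; have hi := ltn_ord i.
have := rank_simpleB i x; have := rank_simpleB i y.
by move=> /= [[? ?]|[[? ?]|[[? ?]|[[? ?]|[? [? [? [? ?]]]]]]]]
  [[? ?]|[[? ?]|[[? ?]|[[? ?]|[? [? [? [? ?]]]]]]]]; lia.
Qed.

(** Strong exchange. Peel off the last letter [t]: if it keeps [x] and [g x] in order, induct with
    [t g t]; otherwise [t] exchanges them, so [g = t] and the last letter cancels. *)
Lemma exchange n (g : {perm 'I_n * bool}) x (e : seq 'I_n) :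
  reflection_like g -> rank x < rank (g x) ->
  rank ((\prod_(i <- e) simpleB i)^-1 (g x)) <
    rank ((\prod_(i <- e) simpleB i)^-1 x) ->
  exists2 e', (size e').+1 = size e &
    (\prod_(i <- e) simpleB i) * g = \prod_(i <- e') simpleB i.
Proof.
elim/last_ind: e g x => [|e t IH] g x hg hx.
  by rewrite big_nil invg1 !perm1; lia.
have tK := refl_invol (simpleB_reflection t).
rewrite -cats1 big_cat big_seq1 /= invMg simpleBV !permM => hv.
have [hlt|hge] := ltnP (rank (simpleB t x)) (rank (simpleB t (g x))).
  have [] := IH (simpleB t * g * simpleB t) (simpleB t x).
  - exact: reflection_like_conj.
  - by rewrite !permM tK.
  - by rewrite !permM tK.
  move=> e' hs he; exists (rcons e' t).
    by rewrite size_cat size_rcons hs /= addn1.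
  rewrite -cats1 big_cat big_seq1 -he /= !mulgA -!(mulgA _ (simpleB t)).
  by rewrite simpleBK mulg1.
have et : simpleB t x = g x.
  apply: simpleB_inversion => //; rewrite ltn_neqAle hge andbT.
  by apply/eqP => /rank_inj /perm_inj he; move: hx; rewrite he ltnn.
exists e; first by rewrite size_cat addn1.
rewrite (_ : g = simpleB t) ?mulgK -?mulgA ?simpleBK ?mulg1 //.
apply: (reflection_like_eq (x := x)) => //; first exact: simpleB_reflection.
by apply/eqP => he; move: hx; rewrite he ltnn.
Qed.

(** * Length and Bruhat order under right multiplication *)

Lemma coxlength_word (gT : finGroupType) n (s : 'I_n -> gT) w :
  w \in coxgroup s ->
  exists2 e : seq 'I_n, size e = coxlength s w & w = \prod_(i <- e) s i.
Proof.
rewrite /coxlength; case: ex_minnP => k h _ hw.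
move: h; rewrite hw => /existsP [e /eqP he].
by exists e; rewrite ?size_tuple.
Qed.

Lemma coxlength_le (gT : finGroupType) n (s : 'I_n -> gT) (e : seq 'I_n) :
  coxlength s (\prod_(i <- e) s i) <= size e.
Proof.
rewrite /coxlength; case: ex_minnP => k _; apply; apply/implyP => _.
by apply/existsP; exists (in_tuple e).
Qed.

Lemma simple_coxgroup (gT : finGroupType) n (s : 'I_n -> gT) i :
  s i \in coxgroup s.
Proof. by apply: mem_gen; apply: imset_f. Qed.

(** Exchange deletes a letter from a shortest word for [v * simpleB i], and the remaining word
    spells [v]. *)
Lemma coxlength_lt_mulB n (v : {perm 'I_n * bool}) (i : 'I_n) :
  v \in coxgroup (@simpleB n) ->
  rank (v^-1 (i, false)) < rank (v^-1 (simpleB i (i, false))) ->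
  coxlength (@simpleB n) v < coxlength (@simpleB n) (v * simpleB i).
Proof.
move=> hv hlt; have si := simpleB_reflection i.
have [e <- he] := coxlength_word (groupM hv (simple_coxgroup (@simpleB n) i)).
have [|||e' <- he'] := @exchange n (simpleB i) (i, false) e.
- exact: si.
- exact: rank_simpleB_lt.
- by rewrite -he invMg simpleBV !permM (refl_invol si).
rewrite ltnS -[v]mulg1 -(simpleBK i) mulgA he he'; exact: coxlength_le.
Qed.

Lemma connect_coxlength (gT : finGroupType) n (s : 'I_n -> gT) u w :
  connect (bruhat_step s) u w -> u != w -> coxlength s u < coxlength s w.
Proof.
move=> /connectP [p]; elim: p u => [|x p IH] u /=.
  by move=> _ ->; rewrite eqxx.
move=> /andP [/andP [_ hux] hp] hw _.
have [e|hne] := eqVneq x w; first by rewrite -e.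
exact: ltn_trans hux (IH _ hp hw hne).
Qed.

(** Bruhat steps increase length, so lengths decide. If the ranks come in the other order,
    [coxlength_lt_mulB] for [v * simpleB i] makes [v] the longer one. *)
Lemma bruhat_lt_mulB n (v : {perm 'I_n * bool}) (i : 'I_n) :
  v \in coxgroup (@simpleB n) ->
  bruhat_lt (@simpleB n) v (v * simpleB i) =
    (rank (v^-1 (i, false)) < rank (v^-1 (simpleB i (i, false)))).
Proof.
move=> hv; have si := simpleB_reflection i.
apply/andP/idP => [[hne /connect_coxlength /(_ hne) hl]|hlt].
  rewrite ltnNge leq_eqVlt; apply/negP.
  case/orP => [/eqP /rank_inj /perm_inj he|hgt].
    by have := rank_simpleB_lt i; rewrite he ltnn.
  have := @coxlength_lt_mulB n (v * simpleB i) i.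
  rewrite invMg simpleBV !permM (refl_invol si) -mulgA simpleBK mulg1.
  move=> /(_ (groupM hv (simple_coxgroup _ i)) hgt); lia.
have hl := coxlength_lt_mulB hv hlt; split.
  by apply/eqP => e; move: hl; rewrite -e ltnn.
apply: connect1; rewrite /bruhat_step /= mulKg hl andbT.
apply/existsP; exists i; apply/existsP; exists 1.
by rewrite group1 conjg1 eqxx.
Qed.

(** * Diagrams as pipe networks *)

Lemma coxgroupB_bar n (v : {perm 'I_n * bool}) x :
  v \in coxgroup (@simpleB n) -> v (bar x) = bar (v x).
Proof.
move=> /coxlength_word [e _ ->]; elim: e x => [|i e IH] x.
  by rewrite big_nil !perm1.
by rewrite big_cons !permM (refl_bar (simpleB_reflection i)) IH.
Qed.

Lemma simpleB_next n (i j : 'I_n) : j = i.+1 :> nat ->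
  simpleB i (i, false) = (j, false).
Proof.
move=> h; apply: rank_inj; have := rank_simpleB i (i, false).
by rewrite /rank /=; have := ltn_ord j; lia.
Qed.

Lemma simpleB_prev n (i j : 'I_n) : j = i.+1 :> nat ->
  simpleB i (j, false) = (i, false).
Proof.
by move=> /simpleB_next <-; rewrite (refl_invol (simpleB_reflection i)).
Qed.

Lemma simpleB_last n (i : 'I_n) : i.+1 = n ->
  simpleB i (i, false) = bar (i, false).
Proof.
move=> h; apply: rank_inj; have := rank_simpleB i (i, false).
by have := rank_bar (i, false); have : rank (i, false) = i by []; lia.
Qed.

Lemma simpleB_fix n (i j : 'I_n) : j <> i :> nat -> j <> i.+1 :> nat ->
  simpleB i (j, false) = (j, false).
Proof.
move=> h1 h2; apply: rank_inj; have := rank_simpleB i (j, false).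
have hi := ltn_ord i; have hj := ltn_ord j.
by have : rank (j, false) = j by []; lia.
Qed.

Lemma box_coord_inj n (x y : box n) :
  box_row x = box_row y -> box_col x = box_col y -> x = y.
Proof.
move=> hr hc; apply: val_inj; apply/eqP.
by rewrite -pair_eqE /= -!val_eqE /=; apply/andP; split; apply/eqP.
Qed.

Lemma box_exists n r c : r + c < n ->
  exists z : box n, box_row z = r /\ box_col z = c.
Proof.
move=> h; have hr : r < n by lia.
have hc : c < n by lia.
pose q := (Ordinal hr, Ordinal hc).
by exists (exist (fun p : 'I_n * 'I_n => p.1 + p.2 < n) q h).
Qed.

Lemma box_le_coord n (x y : box n) :
  box_row y <= box_row x -> box_col x <= box_col y -> box_le x y.
Proof.
have [s] := ubnP ((box_row x - box_row y) + (box_col y - box_col x)).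
elim: s => // s IH in x *; move=> hs hr hc.
have hx : box_row x + box_col x < n := valP x.
have hy : box_row y + box_col y < n := valP y.
have [er|nr] := eqVneq (box_row x) (box_row y).
  have [ec|nc] := eqVneq (box_col x) (box_col y).
    by rewrite (box_coord_inj er ec); apply: connect0.
  have [z [zr zc]] := @box_exists n (box_row x) (box_col x).+1 ltac:(lia).
  apply: connect_trans (connect1 _) (IH z _ _ _); try lia.
  by rewrite /box_cover /= zr zc !eqxx.
have [z [zr zc]] := @box_exists n (box_row x).-1 (box_col x) ltac:(lia).
apply: connect_trans (connect1 _) (IH z _ _ _); try lia.
by rewrite /box_cover /= zr zc eqxx orbC prednK ?eqxx //; lia.
Qed.

Section Diagrams.

Variables (n : nat) (O : {set box n}) (m : nat) (b : m.-tuple (box_in O)).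
Variable D : oplus_diagram O.
Hypotheses (hO : order_ideal O) (hb : linear_extension b).

Let brow (z : box_in O) := box_row (val z).
Let bcol (z : box_in O) := box_col (val z).
Let at_coord (r c : nat) (z : box_in O) := (brow z == r) && (bcol z == c).

Let inO (r c : nat) := [exists z : box_in O, at_coord r c z].
Let plus (r c : nat) :=
  [exists z : box_in O,
     at_coord r c z && (if D z is Plus then true else false)].
(** The word reads [b] backwards, hence the reversed index. *)
Let time (r c : nat) :=
  if [pick z : box_in O | at_coord r c z] is Some z then m - (index z b).+1
  else 0.
Let row k := if insub k is Some i then brow (word_box b i) else 0.
Let col k := if insub k is Some i then bcol (word_box b i) else 0.
(** Permutations compose from left to right, so [(v * s)^-1] maps [x] to [v^-1 (s x)] for an
    involution [s]: right multiplication permutes positions. *)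
Let P k i :=
  if insub i is Some j then rank ((subword_prod b D k)^-1 (j : 'I_n, false))
  else 0.

Let rowE (k : 'I_m) : row k = brow (word_box b k).
Proof. by rewrite /row valK. Qed.

Let colE (k : 'I_m) : col k = bcol (word_box b k).
Proof. by rewrite /col valK. Qed.

Let PE k (i : 'I_n) : P k i = rank ((subword_prod b D k)^-1 (i, false)).
Proof. by rewrite /P valK. Qed.

Let at_coord_inj r c z z' : at_coord r c z -> at_coord r c z' -> z = z'.
Proof.
move=> /andP [/eqP h1 /eqP h2] /andP [/eqP h3 /eqP h4].
apply: val_inj; apply: box_coord_inj.
  by rewrite -/(brow z) h1 -h3.
by rewrite -/(bcol z) h2 -h4.
Qed.

Let inO_box (z : box_in O) : inO (brow z) (bcol z).
Proof. by apply/existsP; exists z; rewrite /at_coord !eqxx. Qed.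

Let inOP r c : inO r c -> exists2 z : box_in O, brow z = r & bcol z = c.
Proof. by move=> /existsP [z /andP [/eqP h1 /eqP h2]]; exists z. Qed.

Let plusE z : plus (brow z) (bcol z) = if D z is Plus then true else false.
Proof.
apply/existsP/idP => [[z' /andP [h1 h2]]|h].
  by rewrite (at_coord_inj (z := z) (z' := z') _ h1) // /at_coord !eqxx.
by exists z; rewrite h /at_coord !eqxx.
Qed.

Let plus_inO r c : plus r c -> inO r c.
Proof. by move=> /existsP [z /andP [hz _]]; apply/existsP; exists z. Qed.

Let timeE z : time (brow z) (bcol z) = m - (index z b).+1.
Proof.
rewrite /time; case: pickP => [z' h|/(_ z)]; last by rewrite /at_coord !eqxx.
by rewrite (at_coord_inj (z := z) _ h) // /at_coord !eqxx.
Qed.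

Let index_lt (z : box_in O) : index z b < m.
Proof. by case: hb => _ hall _; rewrite -{2}(size_tuple b) index_mem hall. Qed.

Let word_box_time (z : box_in O) (h : time (brow z) (bcol z) < m) :
  word_box b (Ordinal h) = z.
Proof.
case: hb => _ hall _.
have hi := index_lt z.
rewrite /word_box (tnth_nth z) /= timeE (_ : m - _ = index z b); last by lia.
by rewrite nth_index.
Qed.

Let time_word_box (k : 'I_m) :
  time (brow (word_box b k)) (bcol (word_box b k)) = k.
Proof.
case: hb => hu _ _; have hk := ltn_ord k.
rewrite timeE /word_box (tnth_nth (word_box b k)).
by rewrite index_uniq ?size_tuple //=; lia.
Qed.

Let subword_prodS (k : 'I_m) :
  subword_prod b D k.+1 = subword_prod b D k * word_factor b D k.
Proof.
(* Extending the factors to all naturals turns the filtered product into one over ['I_j], whose last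
   factor splits off. *)
pose F j := if insub j is Some i then word_factor b D i else 1.
have prodE j : j <= m -> subword_prod b D j = \prod_(i < j) F i.
  move=> hj; rewrite (big_ord_widen m F hj); apply: eq_bigr => i _.
  by rewrite /F valK.
rewrite !prodE; [|exact/ltnW/ltn_ord|exact: ltn_ord].
by rewrite big_ord_recr /= {2}/F valK.
Qed.

Let subword_prod_coxgroup k : subword_prod b D k \in coxgroup (@simpleB n).
Proof.
apply: group_prod => i _; rewrite /word_factor.
by case: (D _); rewrite ?group1 //; apply: (simple_coxgroup (@simpleB n)).
Qed.

Let labelE z : label (val z) = brow z + bcol z :> nat.
Proof. by []. Qed.

Let PS k i : k < m -> i < n ->
  P k.+1 i =
    let l := row k + col k in
    if plus (row k) (col k) then P k i
    else if i == l then if l.+1 < n then P k l.+1 else (n + n).-1 - P k l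
    else if i == l.+1 then P k l else P k i.
Proof.
move=> km hi.
have [[{}k -> {km}] [{}i -> {hi}]] :
    (exists k' : 'I_m, k = k') /\ exists i' : 'I_n, i = i'.
  by split; [exists (Ordinal km) | exists (Ordinal hi)].
rewrite /= rowE colE plusE !PE subword_prodS /word_factor /word_refl.
set z := word_box b k; case: (D z); last by rewrite mulg1.
rewrite -labelE invMg simpleBV permM; set l := label _.
case: eqP => [e|n1].
  have -> : i = l by apply: val_inj.
  case: ifP => hl.
    by rewrite -[l.+1]/(val (Ordinal hl)) PE (simpleB_next (j := Ordinal hl)).
  rewrite simpleB_last; last by have := ltn_ord l; lia.
  rewrite coxgroupB_bar ?groupV ?subword_prod_coxgroup //.
  have := rank_bar ((subword_prod b D k)^-1 (l, false)).
  by rewrite PE => <-; rewrite addnK.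
case: eqP => [e|n2]; first by rewrite simpleB_prev // PE.
by rewrite simpleB_fix.
Qed.

(** On the diagonal the length criterion compares the ranks of a vector and its opposite; as they
    add up to [2n - 1], it says that the first is below [n]. *)
Let gammaE : gamma_diagram b D <-> increasing_steps n m row col P.
Proof.
suff step (k : 'I_m) :
    bruhat_lt (@simpleB n) (subword_prod b D k)
      (subword_prod b D k * word_refl b k) =
    (let l := row k + col k in P k l < (if l.+1 < n then P k l.+1 else n)).
  split=> h k; last by rewrite step; apply: h.
  by move=> km; rewrite -[k]/(val (Ordinal km)) -step; apply: h.
rewrite /word_refl bruhat_lt_mulB ?subword_prod_coxgroup //= rowE colE -labelE.
set l := label _; rewrite PE; case: ifP => hl.
  by rewrite -[l.+1]/(val (Ordinal hl)) PE (simpleB_next (j := Ordinal hl)).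
rewrite simpleB_last; last by have := ltn_ord l; lia.
rewrite coxgroupB_bar ?groupV ?subword_prod_coxgroup //.
by have := rank_bar ((subword_prod b D k)^-1 (l, false)); lia.
Qed.

Lemma gamma_diagramP : gamma_diagram b D <->
  (forall z y : box_in O, D z = Zero -> D y = Plus -> above (val z) (val y) ->
     forall x : box_in O, left_of (val x) (val z) -> D x = Zero) /\
  (forall z : box_in O, diagonal (val z) -> D z = Zero ->
     forall x : box_in O, left_of (val x) (val z) -> D x = Zero).
Proof.
have zeroE z : D z = Zero <-> ~~ plus (brow z) (bcol z).
  by rewrite plusE; case: (D z).
have plusP z : D z = Plus <-> plus (brow z) (bcol z).
  by rewrite plusE; case: (D z).
apply: (iff_trans gammaE).
apply: (iff_trans (increasing_stepsP (inO := inO) (plus := plus) (time := time)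
  _ _ _ _ _ _ _ _ _ _ PS)).
- by move=> r c /inOP [z <- <-]; apply: (valP (val z)).
- move=> r c r' c' /inOP [z <- <-] hr hc hl.
  have [x [xr xc]] := box_exists hl; subst r c.
  have hx : x \in O by apply: hO (box_le_coord _ _) (valP z).
  by rewrite -[x]/(val (exist (fun z => z \in O) x hx)); apply: inO_box.
- move=> r c r' c' /inOP [x <- <-] /inOP [y <- <-] hr hc; rewrite !timeE.
  case: hb => _ hall hle.
  have := hle (Ordinal (index_lt x)) (Ordinal (index_lt y)).
  have tnthK z : tnth b (Ordinal (index_lt z)) = z.
    by rewrite (tnth_nth z) nth_index // hall.
  rewrite !tnthK => /(_ (box_le_coord hr hc)) /= hxy; exact: leq_sub2l.
- by move=> r c /inOP [z <- <-]; rewrite timeE; have := index_lt z; lia.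
- move=> r c /inOP [z <- <-].
  have h : time (brow z) (bcol z) < m by rewrite timeE; have := index_lt z; lia.
  by rewrite -[time _ _]/(val (Ordinal h)) rowE word_box_time.
- move=> r c /inOP [z <- <-].
  have h : time (brow z) (bcol z) < m by rewrite timeE; have := index_lt z; lia.
  by rewrite -[time _ _]/(val (Ordinal h)) colE word_box_time.
- by move=> k km; rewrite -[k]/(val (Ordinal km)) rowE colE.
- by move=> k km; rewrite -[k]/(val (Ordinal km)) rowE colE time_word_box.
- exact: plus_inO.
- move=> i hi; rewrite -[i]/(val (Ordinal hi)) PE /subword_prod.
  by rewrite big1 ?invg1 ?perm1.
split=> [] [hook diag]; split.
- move=> z y hz hy /andP [/eqP hc hr] x /andP [/eqP er hlt].
  apply/zeroE; rewrite (er : brow x = brow z).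
  apply: (hook _ (brow y) (bcol z)) (inO_box z) (proj1 (zeroE z) hz) _ hr hlt.
  by rewrite (hc : bcol z = bcol y); apply/plusP.
- move=> z /eqP hd hz x /andP [/eqP er hlt].
  apply/zeroE; rewrite (er : brow x = brow z).
  exact: diag (inO_box z) hd (proj1 (zeroE z) hz) hlt.
- move=> r r' c c' /inOP [z <- <-] /zeroE hz hp hr hc.
  (* A plus occurs only inside [O], so these coordinates come from boxes of the diagram. *)
  have [y yr yc] := inOP (plus_inO hp).
  apply/negP => hx; have [x xr xc] := inOP (plus_inO hx); subst r' c'.
  rewrite -xr in hx; rewrite -yc in hp.
  suff /zeroE : D x = Zero by rewrite hx.
  apply: (hook z y) => //; first exact/plusP; apply/andP; split=> //; exact/eqP.
- move=> r c c' /inOP [z <- <-] hd /zeroE hz hc.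
  apply/negP => hx; have [x xr xc] := inOP (plus_inO hx); subst c'.
  rewrite -xr in hx; suff /zeroE : D x = Zero by rewrite hx.
  apply: (diag z) => //; first exact/eqP; apply/andP; split=> //; exact/eqP.
Qed.

End Diagrams.

Theorem mainTheorem4 (n : nat) (hn : 2 <= n)
    (O : {set box n}) (hO : order_ideal O)
    (m : nat) (b : m.-tuple (box_in O)) (hb : linear_extension b)
    (D : oplus_diagram O) :
  gamma_diagram b D <->
  (forall z y : box_in O, D z = Zero -> D y = Plus -> above (val z) (val y) ->
     forall x : box_in O, left_of (val x) (val z) -> D x = Zero) /\
  (forall z : box_in O, diagonal (val z) -> D z = Zero ->
     forall x : box_in O, left_of (val x) (val z) -> D x = Zero).
Proof. exact: gamma_diagramP. Qed.
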